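(* Let $m\ge 1$ be an integer and let $G$ be a finite simple graph with vertex set $V(G)=\{v_1,\dots,v_n\}$. Let $\mathrm{Spl}_m(G)$ be the $m$-splitting graph of $G$, with vertex set $V(G)\cup\{v_i^k : 1\le i\le n,\ 1\le k\le m\}$, where $v_i^1,\dots,v_i^m$ are the $m$ duplicates of $v_i$. Then for every $i\in\{1,\dots,n\}$, \[ \mathcal{E}_{\mathrm{Spl}_m(G)}(v_i)=\frac{2m+1}{\sqrt{4m+1}}\,\mathcal{E}_G(v_i), \] and for every $i\in\{1,\dots,n\}$ and every $k\in\{1,\dots,m\}$, \[ \mathcal{E}_{\mathrm{Spl}_m(G)}(v_i^k)=\frac{2}{\sqrt{4m+1}}\,\mathcal{E}_G(v_i). \]
   Context: Vertex energy: for a finite simple (undirected, loopless) graph $H$ with vertices $w_1,\dots,w_N$ and adjacency matrix $A(H)$, write the spectral decomposition $A(H)=\sum_{i=1}^N \lambda_i u_iu_i^T$, where $\lambda_1,\dots,\lambda_N$ are the eigenvalues of $A(H)$ (with multiplicity) and $u_i=(u_{i1},\dots,u_{iN})^T$ are corresponding orthonormal real eigenvectors. The vertex energy of $w_k$ is $\mathcal{E}_H(w_k)=\sum_{i=1}^N|\lambda_i|\,u_{ik}^2$ (this does not depend on the choice of orthonormal eigenbasis). $m$-splitting graph: for a simple graph $G$ with $V(G)=\{v_1,\dots,v_n\}$, $\mathrm{Spl}_m(G)$ is the graph obtained by adding, for each vertex $v_i$, $m$ new vertices $v_i^1,\dots,v_i^m$, and joining each $v_i^k$ to all the neighbours of $v_i$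 in $G$. That is, $V(\mathrm{Spl}_m(G))=V(G)\cup\{v_i^k:1\le i\le n,\ 1\le k\le m\}$ and $E(\mathrm{Spl}_m(G))=E(G)\cup\{v_i^kv_j : v_iv_j\in E(G),\ 1\le k\le m\}$ (for every edge of $G$, both orderings of its endpoints are used). *)

(* Defs.v *)
From mathcomp Require Import all_boot all_order all_algebra.
From mathcomp Require Import complex.

Set Implicit Arguments.
Unset Strict Implicit.
Unset Printing Implicit Defensive.

Import Order.TTheory GRing.Theory Num.Theory.

Local Open Scope ring_scope.

Record sgraph := SGraph {
  vertex :> finType;
  adj : rel vertex;
  adj_sym : symmetric adj;
  adj_irr : irreflexive adj }.

(* [inl v] is the original vertex v, and [inr (v, k)] its k-th duplicate. *)
Section Splitting.
Variables (m : nat) (G : sgraph).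

Definition spl_adj (x y : G + G * 'I_m) : bool :=
  match x, y with
  | inl u, inl v => adj u v
  | inl u, inr (v, _) => adj u v
  | inr (u, _), inl v => adj u v
  | inr _, inr _ => false
  end.

Lemma spl_adj_sym : symmetric spl_adj.
Proof. by move=> [u|[u k]] [v|[v l]] //=; rewrite adj_sym. Qed.

Lemma spl_adj_irr : irreflexive spl_adj.
Proof. by move=> [u|[u k]] //=; rewrite adj_irr. Qed.

Definition Spl : sgraph := @SGraph (G + G * 'I_m)%type spl_adj spl_adj_sym spl_adj_irr.

End Splitting.

(* Vertex w corresponds to row and column [enum_rank w]. *)
Definition adj_mx (R : pzSemiRingType) (H : sgraph) : 'M[R]_#|H| :=
  \matrix_(i, j) (adj (enum_val i) (enum_val j))%:R.

Lemma adj_mx_sym (R : pzSemiRingType) (H : sgraph) : (adj_mx R H)^T = adj_mx R H.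
Proof. by apply/matrixP => i j; rewrite !mxE adj_sym. Qed.

(* p = (lambda, U): the eigenvalues are the entries of lambda, and the
   eigenvector u_i is the i-th column of U. *)
Definition spectral_decomposition (R : rcfType) (N : nat) (A : 'M[R]_N)
    (p : 'rV[R]_N * 'M[R]_N) : bool :=
  let lambda i := p.1 0 i in
  let u i := col i p.2 in
  [&& [forall i, forall j, (u i)^T *m u j == (i == j)%:R%:M],
      [forall i, A *m u i == lambda i *: u i]
    & A == \sum_i lambda i *: (u i *m (u i)^T)].

Section Spectral.
Variable R : rcfType.

Lemma spectral_decompositionP N (A : 'M[R]_N) (p : 'rV[R]_N * 'M[R]_N) :
  reflect (p.2^T *m p.2 = 1%:M /\ A = p.2 *m diag_mx p.1 *m p.2^T)
          (spectral_decomposition A p).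
Proof.
case: p => l U /=.
have sumE : \sum_i l 0 i *: (col i U *m (col i U)^T) = U *m diag_mx l *m U^T.
  apply/matrixP => i j; rewrite summxE !mxE; apply: eq_bigr => k _.
  by rewrite mul_mx_diag !mxE big_ord1 !mxE mulrA [l 0 k * _]mulrC.
have orthE : U^T *m U = 1%:M <->
    forall i j, (col i U)^T *m col j U = (i == j)%:R%:M.
  split=> [UU i j|UU].
    apply/matrixP=> a b; rewrite !ord1 !mxE eqxx mulr1n.
    move/matrixP/(_ i j): UU; rewrite !mxE => <-.
    by apply: eq_bigr => k _; rewrite !mxE.
  apply/matrixP=> i j; move/matrixP/(_ 0 0): (UU i j).
  rewrite !mxE eqxx mulr1n => <-.
  by apply: eq_bigr => k _; rewrite !mxE.
apply: (iffP and3P) => /= [[/'forall_'forall_eqP UU _ /eqP ->]|[UU AE]].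
  by rewrite sumE; split=> //; apply/orthE.
split; last by rewrite sumE AE.
  by apply/'forall_'forall_eqP; apply/orthE.
apply/forallP=> i; apply/eqP.
have -> : A *m col i U = col i (A *m U) by rewrite !colE mulmxA.
rewrite AE -[_ *m _ *m U]mulmxA UU mulmx1.
by apply/matrixP=> a b; rewrite mul_mx_diag !mxE mulrC.
Qed.

Lemma sym_eigenvalue n (A : 'M[R]_n.+1) : A^T = A -> exists a, eigenvalue A a.
Proof.
move=> Asym; pose f : {rmorphism R -> complex R} := real_complex R.
pose A' := map_mx f A.
have [z rz] : exists z, root (char_poly A') z.
  by apply/closed_rootP; rewrite size_char_poly.
move: (rz); rewrite -eigenvalue_root_char => /eigenvalueP[v vA v0].
pose vs := (map_mx Num.conj v)^T.
have A'c : map_mx Num.conj A' = A'.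
  by apply/matrixP=> i j; rewrite !mxE /f; apply/CrealP; rewrite complex_real.
have A't : A'^T = A' by apply/matrixP=> i j; rewrite !mxE -{2}Asym mxE.
have Avs : A' *m vs = z^* *: vs.
  rewrite /vs -{1}A't -{1}A'c -trmx_mul -map_mxM vA.
  by apply/matrixP=> i j; rewrite !mxE rmorphM.
have vvs : (v *m vs) 0 0 != 0.
  have [j vj] : exists j, v 0 j != 0 by apply/rV0Pn.
  rewrite mxE psumr_neq0; last by move=> i _; rewrite !mxE mul_conjC_ge0.
  by apply/hasP; exists j; rewrite ?mem_index_enum // !mxE mul_conjC_gt0.
have zr : z^* = z.
  apply: (mulIf vvs); have := erefl (v *m A' *m vs).
  rewrite -{1}mulmxA Avs vA -scalemxAl -scalemxAr => /matrixP/(_ 0 0).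
  by rewrite !mxE.
have zR : z = f (complex.Re z) by apply/esym/RRe_real/CrealP.
exists (complex.Re z); rewrite eigenvalue_root_char.
by rewrite -(fmorph_root f) map_char_poly -zR.
Qed.

Lemma householder n (v : 'rV[R]_n.+1) : v *m v^T = 1%:M ->
  exists H : 'M[R]_n.+1, [/\ H^T = H, H *m H = 1%:M & delta_mx 0 0 *m H = v].
Proof.
move=> v1; pose e : 'rV[R]_n.+1 := delta_mx 0 0.
have [<-|ve] := eqVneq e v.
  by exists 1%:M; rewrite trmx1 !mulmx1.
have [w wE] : exists w, w = e - v by exists (e - v).
pose c := (w *m w^T) 0 0.
have e1 : e *m e^T = 1%:M.
  by rewrite trmx_delta mul_delta_mx; apply/matrixP=> i j; rewrite !ord1 !mxE.
have vee : v *m e^T = e *m v^T.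
  by rewrite -[LHS]trmxK trmx_mul trmxK; apply/matrixP=> i j; rewrite !ord1 mxE.
have cE : w *m w^T = c%:M by rewrite [LHS]mx11_scalar.
have c0 : c != 0.
  have [j wj] : exists j, w 0 j != 0 by apply/rV0Pn; rewrite wE subr_eq0.
  rewrite /c mxE psumr_neq0; last by move=> i _; rewrite [w^T _ _]mxE -expr2 sqr_ge0.
  apply/hasP; exists j; rewrite ?mem_index_enum //= [w^T _ _]mxE -expr2.
  by rewrite exprn_even_gt0.
have ew : e *m w^T = (c / 2)%:M.
  have : w *m w^T = 2 *: (e *m w^T).
    rewrite wE linearB /= !mulmxBl !mulmxBr.
    by rewrite v1 e1 vee scaler_nat mulr2n opprB.
  rewrite cE => /(congr1 (fun M => 2^-1 *: M)).
  rewrite scalerA mulVf ?pnatr_eq0 // scale1r => <-.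
  by rewrite scale_scalar_mx mulrC.
exists (1%:M - (2 / c) *: (w^T *m w)); split.
- by rewrite linearB linearZ /= trmx1 trmx_mul trmxK.
- rewrite mulmxBl mul1mx mulmxBr mulmx1 -scalemxAl -scalemxAr.
  rewrite mulmxA -(mulmxA w^T) cE mul_mx_scalar -scalemxAl !scalerA.
  have -> : 2 / c * (2 / c * c) = 2 / c *+ 2.
    by rewrite divfK // mulr_natr.
  by rewrite -scalerMnl mulr2n opprB addrK subrK.
- rewrite mulmxBr mulmx1 -scalemxAr mulmxA ew mul_scalar_mx scalerA.
  rewrite mulrA divfK // divff ?pnatr_eq0 // scale1r.
  by rewrite wE opprB addrC subrK.
Qed.

Lemma sym_diag n (A : 'M[R]_n) : A^T = A ->
  exists p : 'rV[R]_n * 'M[R]_n,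
    p.2^T *m p.2 = 1%:M /\ A = p.2 *m diag_mx p.1 *m p.2^T.
Proof.
elim: n A => [|n IHn] A Asym.
  by exists (0, 0); split; apply/matrixP=> -[].
have [a /eigenvalueP[x xA x0]] := sym_eigenvalue Asym.
pose s := (x *m x^T) 0 0.
have sE : x *m x^T = s%:M by rewrite [LHS]mx11_scalar.
have s0 : 0 < s.
  have [j xj] : exists j, x 0 j != 0 by apply/rV0Pn.
  rewrite lt_def /s mxE sumr_ge0 ?andbT; last first.
    by move=> i _; rewrite mxE -expr2 sqr_ge0.
  rewrite psumr_neq0; last by move=> i _; rewrite !mxE -expr2 sqr_ge0.
  apply/hasP; exists j; rewrite ?mem_index_enum //= mxE -expr2.
  by rewrite exprn_even_gt0.
pose v := (Num.sqrt s)^-1 *: x.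
have v1 : v *m v^T = 1%:M.
  rewrite linearZ /= -scalemxAl -scalemxAr scalerA sE scale_scalar_mx.
  by rewrite -invfM -expr2 sqr_sqrtr ?ltW // mulVf ?gt_eqF.
have vA : v *m A = a *: v by rewrite -scalemxAl xA !scalerA mulrC.
have [H [Hs HH Hv]] := householder v1.
have [B BD] : exists B : 'M[R]_(1 + n), B = H *m A *m H by exists (H *m A *m H).
have Bs : B^T = B by rewrite BD !trmx_mul Hs Asym mulmxA.
have eB : delta_mx 0 0 *m B = a *: (delta_mx 0 0 : 'rV_n.+1).
  rewrite BD !mulmxA Hv vA -scalemxAl; congr (_ *: _).
  by rewrite -Hv -mulmxA HH mulmx1.
have B0 j : B 0 j = a * (j == 0)%:R.
  by move/matrixP/(_ 0 j): eB; rewrite -rowE !mxE eqxx.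
pose B' := drsubmx B.
have BE : B = block_mx a%:M 0 0 B'.
  rewrite -[LHS]submxK; congr block_mx.
  - apply/matrixP=> i j; rewrite !ord1 !mxE lshift0 B0 eqxx /= mulr1 mulr1n//.
  - apply/matrixP=> i j; rewrite ord1 !mxE lshift0 B0.
    by rewrite -val_eqE /= mulr0.
  - apply/matrixP=> i j; rewrite ord1 !mxE lshift0 -Bs mxE B0.
    by rewrite -val_eqE /= mulr0.
have B's : B'^T = B' by rewrite /B' trmx_drsub Bs.
have [[d U] /= [UU B'E]] := IHn _ B's.
pose V : 'M[R]_(1 + n) := block_mx 1%:M 0 0 U.
have VV : V^T *m V = 1%:M.
  rewrite tr_block_mx mulmx_block !trmx0 !trmx1 !mulmx0 !mul0mx UU mulmx1.
  by rewrite !addr0 add0r -scalar_mx_block.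
exists (row_mx a%:M d, H *m V); split=> /=.
  by rewrite trmx_mul Hs mulmxA -(mulmxA _ H H) HH mulmx1.
rewrite trmx_mul Hs.
have -> : A = H *m B *m H by rewrite BD !mulmxA HH mul1mx -mulmxA HH mulmx1.
have -> : B = V *m diag_mx (row_mx a%:M d) *m V^T.
  rewrite BE diag_mx_row /V tr_block_mx !mulmx_block !trmx0 !trmx1.
  rewrite !(mulmx0, mul0mx, addr0, add0r, mulmx1, mul1mx) -B'E.
  congr block_mx; apply/matrixP=> i j; rewrite !ord1 !mxE //.
by rewrite !mulmxA.
Qed.

Lemma spectral_decomposition_exists n (A : 'M[R]_n) : A^T = A ->
  exists p, spectral_decomposition A p.
Proof.
by move=> /sym_diag[p pP]; exists p; apply/spectral_decompositionP.
Qed.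

Lemma spectral_norm_indep n (A : 'M[R]_n) p q k :
  spectral_decomposition A p -> spectral_decomposition A q ->
  \sum_i `|p.1 0 i| * p.2 k i ^+ 2 = \sum_i `|q.1 0 i| * q.2 k i ^+ 2.
Proof.
case: p q => [l U] [d W] /spectral_decompositionP /= [UU AU].
move=> /spectral_decompositionP /= [WW AW].
have UU' := mulmx1C UU; have WW' := mulmx1C WW.
pose M := U^T *m W.
have comm : diag_mx l *m M = M *m diag_mx d.
  have : U^T *m A *m W = U^T *m A *m W by [].
  rewrite {1}AU AW !mulmxA UU mul1mx -!mulmxA WW mulmx1 => ->.
  by rewrite /M !mulmxA.
pose abs (t : 'rV[R]_n) := map_mx Num.norm t.
have acomm : diag_mx (abs l) *m M = M *m diag_mx (abs d).
  apply/matrixP=> i j; move/matrixP/(_ i j): comm.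
  rewrite !mul_diag_mx !mul_mx_diag !mxE.
  set x := \sum_j _; have [->|x0] := eqVneq x 0; first by rewrite !mulr0 !mul0r.
  move=> lx; have -> : l 0 i = d 0 j by apply: (mulIf x0); rewrite lx mulrC.
  by rewrite mulrC.
have key (t : 'rV[R]_n) (V : 'M[R]_n) :
    \sum_i `|t 0 i| * V k i ^+ 2 = (V *m diag_mx (abs t) *m V^T) k k.
  rewrite mxE; apply: eq_bigr => i _; rewrite mul_mx_diag !mxE.
  by rewrite mulrAC -expr2 mulrC.
rewrite !key.
suff -> : U *m diag_mx (abs l) *m U^T = W *m diag_mx (abs d) *m W^T by [].
rewrite -[U^T]mulmx1 -WW' !mulmxA -[_ *m U^T *m W]mulmxA -/M.
by rewrite -[U *m _ *m M]mulmxA acomm /M !mulmxA UU' mul1mx.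
Qed.

End Spectral.

Definition spectrum (R : rcfType) (H : sgraph) : 'rV[R]_#|H| * 'M[R]_#|H| :=
  xchoose (spectral_decomposition_exists (adj_mx_sym R H)).

Definition vertex_energy (R : rcfType) (H : sgraph) (w : H) : R :=
  let lambda i := (spectrum R H).1 0 i in
  let u i := col i (spectrum R H).2 in
  \sum_i `|lambda i| * u i (enum_rank w) 0 ^+ 2.

(* The value does not depend on the decomposition chosen in [spectrum]. *)
Lemma vertex_energyE (R : rcfType) (H : sgraph) p (w : H) :
  spectral_decomposition (adj_mx R H) p ->
  vertex_energy R w = \sum_i `|p.1 0 i| * p.2 (enum_rank w) i ^+ 2.
Proof.
move=> pP; have sP : spectral_decomposition (adj_mx R H) (spectrum R H).
  exact: xchooseP.
rewrite -(spectral_norm_indep (enum_rank w) sP pP).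
by apply: eq_bigr => i _; rewrite mxE.
Qed.

(* Main.v *)
Require Import Defs.
From mathcomp Require Import all_boot all_order all_algebra.
From mathcomp Require Import ring.
Set Implicit Arguments.
Unset Strict Implicit.
Unset Printing Implicit Defensive.
Import Order.TTheory GRing.Theory Num.Theory.
Local Open Scope ring_scope.

(** The energy of a vertex is the diagonal entry at that vertex of |A|, the
    absolute value of the adjacency matrix A, and |A| is the only positive
    semidefinite matrix whose square is A^2 ([psdmx_sqr_inj],
    [vertex_energy_sqrt]).

    The adjacency matrix of the m-splitting graph is M (x) A, where M is the
    matrix of size m + 1 that has 1 in its first row and column and 0
    elsewhere.  Hence its absolute value is |M| (x) |A|, and every vertex energy
    is multiplied by the matching diagonal entry of |M|.  With s^2 = 4 m + 1,

      |M| = s^-1 * ( 2m+1  1 ... 1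
                       1   2 ... 2
                      ...
                       1   2 ... 2 ).

    Indeed both M^2 and the square of the right-hand side have m + 1 in the
    upper left corner and 1 elsewhere, and the quadratic form of s |M| at
    (y, z_1, ..., z_m) is, with z the sum of the z_k, the sum of squares
    2m y^2 + (y + z)^2 + z^2.

    All these matrices take one value on the original vertex, one value between
    it and its duplicates, and one value among the duplicates.  So the Kronecker
    product by A is the congruence of a 2 x 2 block matrix by a matrix E that
    copies a vector on G to all the duplicates ([blowup]); since E E^T is the
    block diagonal matrix with blocks 1 and m, squares are computed blockwise
    ([blowup_sqr]). *)

(** * Positive semidefinite square roots *)

Section PositiveSemidefinite.
Variable R : rcfType.

Definition psdmx n (P : 'M[R]_n) :=
  P^T = P /\ forall x : 'rV[R]_n, 0 <= (x *m P *m x^T) 0 0.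

Lemma mxE_delta m n (A : 'M[R]_(m, n)) i j :
  A i j = ((delta_mx 0 i : 'rV_m) *m A *m (delta_mx j 0 : 'cV_n)) 0 0.
Proof. by rewrite -rowE -colE !mxE. Qed.

Lemma orthogonal_diag_tr n (U : 'M[R]_n) l :
  (U *m diag_mx l *m U^T)^T = U *m diag_mx l *m U^T.
Proof. by rewrite !trmx_mul trmxK tr_diag_mx mulmxA. Qed.

Lemma orthogonal_diag_sqr n (U : 'M[R]_n) l : U^T *m U = 1%:M ->
  (U *m diag_mx l *m U^T) *m (U *m diag_mx l *m U^T) =
  U *m diag_mx (\row_i l 0 i ^+ 2) *m U^T.
Proof.
move=> UU; rewrite !mulmxA -[_ *m U^T *m U]mulmxA UU mulmx1.
congr (_ *m _); rewrite -mulmxA mulmx_diag.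
by congr (_ *m diag_mx _); apply/rowP => i; rewrite !mxE expr2.
Qed.

Lemma orthogonal_diag_psd n (U : 'M[R]_n) (l : 'rV[R]_n) : (forall i, 0 <= l 0 i) ->
  psdmx (U *m diag_mx l *m U^T).
Proof.
move=> l0; split=> [|x]; first exact: orthogonal_diag_tr.
have -> : x *m (U *m diag_mx l *m U^T) *m x^T =
          (x *m U) *m diag_mx l *m (x *m U)^T by rewrite trmx_mul !mulmxA.
rewrite mxE sumr_ge0 // => i _.
by rewrite mul_mx_diag !mxE mulrAC -expr2 mulr_ge0 ?sqr_ge0.
Qed.

Lemma psd_diag n (P : 'M[R]_n) : psdmx P ->
  exists (U : 'M[R]_n) (l : 'rV[R]_n), [/\ U^T *m U = 1%:M, forall i, 0 <= l 0 i
    & P = U *m diag_mx l *m U^T].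
Proof.
move=> [Psym P0]; have [[l U] /= [UU PE]] := sym_diag Psym.
exists U, l; split=> // i.
have := P0 (delta_mx 0 i *m U^T).
rewrite PE trmx_mul trmxK !mulmxA -[_ *m U^T *m U]mulmxA UU mulmx1.
rewrite -[_ *m U^T *m U]mulmxA UU mulmx1 trmx_delta -mxE_delta mxE eqxx.
by rewrite mulr1n.
Qed.

(** In the matrix X of the change of basis between eigenbases of P and Q, a nonzero
    entry X i j forces the squares of the i-th eigenvalue of P and of the j-th
    of Q to coincide, hence the eigenvalues themselves as they are nonnegative:
    X intertwines the diagonal forms of P and Q. *)
Lemma psdmx_sqr_inj n (P Q : 'M[R]_n) : psdmx P -> psdmx Q ->
  P *m P = Q *m Q -> P = Q.
Proof.
move=> /psd_diag[U [l [UU l0 ->]]] /psd_diag[W [d [WW d0 ->]]].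
rewrite !orthogonal_diag_sqr // => PQ.
have UU' := mulmx1C UU; have WW' := mulmx1C WW.
pose X := U^T *m W.
have sqrX : diag_mx (\row_i l 0 i ^+ 2) *m X = X *m diag_mx (\row_i d 0 i ^+ 2).
  move/(congr1 (fun Z => U^T *m Z *m W)): PQ.
  rewrite !mulmxA UU mul1mx -[_ *m U^T *m W]mulmxA => ->.
  by rewrite -mulmxA WW mulmx1.
have lXd : diag_mx l *m X = X *m diag_mx d.
  apply/matrixP => i j; move/matrixP/(_ i j): sqrX.
  rewrite !mul_diag_mx !mul_mx_diag !mxE.
  set x := \sum_j _; have [->|x0] := eqVneq x 0; first by rewrite !mulr0 !mul0r.
  rewrite mulrC => /(mulfI x0)/eqP; rewrite eqrXn2 // => /eqP ->.
  by rewrite mulrC.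
rewrite -[U^T]mulmx1 -WW' !mulmxA -[_ *m U^T *m W]mulmxA -/X.
by rewrite -[U *m _ *m X]mulmxA lXd /X !mulmxA UU' mul1mx.
Qed.

Variable H : sgraph.

(** Taking absolute values of the eigenvalues in a spectral decomposition gives a
    positive semidefinite square root of the squared adjacency matrix, whose
    diagonal entries are the vertex energies; uniqueness identifies it with P,
    so a guess for P suffices to know the energies. *)
Lemma vertex_energy_sqrt (P : 'M[R]_#|H|) (w : H) : psdmx P ->
  P *m P = adj_mx R H *m adj_mx R H ->
  vertex_energy R w = P (enum_rank w) (enum_rank w).
Proof.
move=> Ppsd PP.
have [p pP] := spectral_decomposition_exists (adj_mx_sym R H).
rewrite (vertex_energyE w pP); case/spectral_decompositionP: pP => UU AE.
pose absl : 'rV[R]_#|H| := \row_i `|p.1 0 i|.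
have -> : P = p.2 *m diag_mx absl *m p.2^T.
  apply: psdmx_sqr_inj => //; first by apply: orthogonal_diag_psd => i; rewrite mxE.
  rewrite PP {}AE !orthogonal_diag_sqr //; congr (_ *m diag_mx _ *m _).
  by apply/rowP => i; rewrite !mxE real_normK ?num_real.
rewrite mxE; apply: eq_bigr => i _.
by rewrite mul_mx_diag !mxE mulrAC -expr2 mulrC.
Qed.

Lemma adj_mx_sqrt : exists B : 'M[R]_#|H|,
  psdmx B /\ B *m B = adj_mx R H *m adj_mx R H.
Proof.
have [[l U] /= [UU ->]] := sym_diag (adj_mx_sym R H).
exists (U *m diag_mx (\row_i `|l 0 i|) *m U^T); split.
  by apply: orthogonal_diag_psd => i; rewrite mxE.
rewrite !orthogonal_diag_sqr //; congr (_ *m diag_mx _ *m _).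
by apply/rowP => i; rewrite !mxE real_normK ?num_real.
Qed.

End PositiveSemidefinite.

(** * Block matrices over the splitting graph *)

Section Blowup.
Variables (R : rcfType) (m : nat) (G : sgraph).

(** The original vertices and their duplicates make the two blocks of rows; the
    m duplicates of a vertex share one row. *)
Definition split_mx : 'M[R]_(#|G| + #|G|, #|Spl m G|) :=
  col_mx
    (\matrix_(i, j) if enum_val j is inl v then (enum_rank v == i)%:R else 0)
    (\matrix_(i, j) if enum_val j is inr (v, _) then (enum_rank v == i)%:R else 0).

(** This is the Kronecker product of B with the matrix of size m + 1 that has
    entry a at the original vertex, b between it and a duplicate, and d
    between two duplicates. *)
Definition blowup (a b d : R) (B : 'M[R]_#|G|) : 'M[R]_#|Spl m G| :=
  split_mx^T *m block_mx (a *: B) (b *: B) (b *: B) (d *: B) *m split_mx.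

Lemma split_mx_inl (v : G) :
  split_mx *m (delta_mx (enum_rank (inl v : Spl m G)) 0 : 'cV_#|Spl m G|) =
  col_mx (delta_mx (enum_rank v) 0) 0.
Proof.
rewrite mul_col_mx -!colE; congr col_mx; apply/matrixP => i j;
  by rewrite !mxE enum_rankK // ord1 andbT eq_sym.
Qed.

Lemma split_mx_inr (v : G) (k : 'I_m) :
  split_mx *m (delta_mx (enum_rank (inr (v, k) : Spl m G)) 0 : 'cV_#|Spl m G|) =
  col_mx 0 (delta_mx (enum_rank v) 0).
Proof.
rewrite mul_col_mx -!colE; congr col_mx; apply/matrixP => i j;
  by rewrite !mxE enum_rankK // ord1 andbT eq_sym.
Qed.

Lemma blowupE a b d B (x y : Spl m G) :
  blowup a b d B (enum_rank x) (enum_rank y) =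
  match x, y with
  | inl u, inl v => a * B (enum_rank u) (enum_rank v)
  | inl u, inr (v, _) => b * B (enum_rank u) (enum_rank v)
  | inr (u, _), inl v => b * B (enum_rank u) (enum_rank v)
  | inr (u, _), inr (v, _) => d * B (enum_rank u) (enum_rank v)
  end.
Proof.
rewrite mxE_delta /blowup !mulmxA -[_ *m split_mx *m _]mulmxA.
have -> : (delta_mx 0 (enum_rank x) : 'rV_#|Spl m G|) *m split_mx^T =
          (split_mx *m delta_mx (enum_rank x) 0)^T.
  by rewrite trmx_mul trmx_delta.
case: x => [u|[u k]]; case: y => [v|[v l]];
  rewrite ?split_mx_inl ?split_mx_inr tr_col_mx trmx0 trmx_delta;
  rewrite mul_row_block mul_row_col !(mul0mx, mulmx0, addr0, add0r);
  by rewrite -mxE_delta mxE.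
Qed.

Lemma adj_mx_blowup : adj_mx R (Spl m G) = blowup 1 1 0 (adj_mx R G).
Proof.
apply/matrixP => i j; rewrite -[i]enum_valK -[j]enum_valK blowupE mxE !enum_rankK.
case: (enum_val i) => [u|[u k]]; case: (enum_val j) => [v|[v l]];
  by rewrite ?mxE ?enum_rankK ?mul1r ?mul0r.
Qed.

Lemma split_mx_mul_tr :
  split_mx *m split_mx^T = block_mx 1%:M 0 0 (m%:R)%:M.
Proof.
(* Sums over row numbers of the large graph become sums over its vertices, so
   that originals and duplicates separate. *)
have sumE (F : Spl m G -> R) : \sum_(j < #|Spl m G|) F (enum_val j) =
    \sum_v F (inl v) + \sum_v \sum_k F (inr (v, k)).
  rewrite -(big_enum_val (A := Spl m G)) big_sumType /=.
  by rewrite pair_bigA; congr (_ + _); apply: eq_bigr => -[].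
have diagE (i j : 'I_#|G|) :
    \sum_(v : G) (enum_rank v == i)%:R * (enum_rank v == j)%:R = (i == j)%:R :> R.
  rewrite (bigD1 (enum_val i)) //= enum_valK eqxx mul1r big1 ?addr0 // => v vi.
  by rewrite -(can2_eq enum_rankK enum_valK) in vi *; rewrite (negPf vi) mul0r.
rewrite tr_col_mx mul_col_row; congr block_mx; apply/matrixP => i j;
  rewrite !mxE; under eq_bigr => k _ do rewrite !mxE.
- rewrite (sumE (fun x => (if x is inl v then (enum_rank v == i)%:R else 0) *
                 (if x is inl v then (enum_rank v == j)%:R else 0))) diagE.
  by rewrite big1 ?addr0 // => v _; rewrite big1 // => k _; rewrite mul0r.
- rewrite big1 // => k _.
  by case: (enum_val k) => [v|[v l]]; rewrite ?mulr0 ?mul0r.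
- rewrite big1 // => k _.
  by case: (enum_val k) => [v|[v l]]; rewrite ?mulr0 ?mul0r.
rewrite (sumE (fun x => (if x is inr (v, _) then (enum_rank v == i)%:R else 0) *
               (if x is inr (v, _) then (enum_rank v == j)%:R else 0))).
rewrite big1 ?add0r => [|v _]; last by rewrite mul0r.
under eq_bigr => v _ do rewrite sumr_const card_ord.
by rewrite sumrMnl diagE -!mulrnA mulnC.
Qed.

Lemma blowup_sqr a b d B :
  blowup a b d B *m blowup a b d B =
  blowup (a ^+ 2 + m%:R * b ^+ 2) (a * b + m%:R * b * d)
         (b ^+ 2 + m%:R * d ^+ 2) (B *m B).
Proof.
rewrite /blowup !mulmxA -[_ *m split_mx *m _]mulmxA split_mx_mul_tr.
congr (_ *m _); rewrite -!mulmxA; congr (_ *m _).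
rewrite !mulmx_block !(mul0mx, mulmx0, mul1mx, addr0, add0r) !mul_scalar_mx.
rewrite -!(scalemxAl, scalemxAr) !scalerA -!scalerDl.
by congr block_mx; congr (_ *: _); ring.
Qed.

(** The quadratic form splits as a combination of values of the form of B, at y,
    y + z and z, with nonnegative coefficients a - b, b and d - b. *)
Lemma blowup_psd a b d B : 0 <= b -> b <= a -> b <= d -> psdmx B ->
  psdmx (blowup a b d B).
Proof.
move=> b0 ba bd [Bsym B0]; split=> [|x].
  by rewrite /blowup !trmx_mul trmxK tr_block_mx !linearZ /= Bsym !mulmxA.
have [y [z yz]] : exists y z, x *m split_mx^T = row_mx y z.
  by exists (lsubmx (x *m split_mx^T)), (rsubmx (x *m split_mx^T)); rewrite hsubmxK.
have -> : x *m blowup a b d B *m x^T =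
    (a - b) *: (y *m B *m y^T) + b *: ((y + z) *m B *m (y + z)^T)
    + (d - b) *: (z *m B *m z^T).
  rewrite /blowup !mulmxA yz -mulmxA -[split_mx *m _]trmxK trmx_mul trmxK yz.
  rewrite tr_row_mx mul_row_block mul_row_col linearD /=.
  rewrite -!scalemxAr !mulmxDl !mulmxDr -!scalemxAl.
  by apply/matrixP => i j; rewrite !mxE; ring.
have posD (M N : 'M[R]_1) : 0 <= M 0 0 -> 0 <= N 0 0 -> 0 <= (M + N) 0 0.
  by rewrite mxE; apply: addr_ge0.
have posZ (c : R) (M : 'M[R]_1) : 0 <= c -> 0 <= M 0 0 -> 0 <= (c *: M) 0 0.
  by rewrite [(c *: M) 0 0]mxE; apply: mulr_ge0.
by apply/posD; [apply/posD|]; apply/posZ => //; rewrite subr_ge0.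
Qed.

End Blowup.

(** * Vertex energies of the splitting graph *)

Theorem theorem1 (R : rcfType) (m : nat) (hm : (1 <= m)%N) (G : sgraph) :
  (forall v : G,
     vertex_energy R (inl v : Spl m G) =
       (2 * m + 1)%N%:R / Num.sqrt (4 * m + 1)%N%:R * vertex_energy R v) /\
  (forall (v : G) (k : 'I_m),
     vertex_energy R (inr (v, k) : Spl m G) =
       2 / Num.sqrt (4 * m + 1)%N%:R * vertex_energy R v).
Proof.
have [B [Bpsd BB]] := adj_mx_sqrt R G.
set s := Num.sqrt _.
have s_gt0 : 0 < s by rewrite sqrtr_gt0 ltr0n addn1.
have s_neq0 : s != 0 by rewrite gt_eqF.
have s_sqr : s ^+ 2 = 4 * m%:R + 1 by rewrite sqr_sqrtr ?ler0n // natrD natrM.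
pose P := blowup m ((2 * m + 1)%N%:R / s) s^-1 (2 / s) B.
have Ppsd : psdmx P.
  have sV_ge0 : 0 <= s^-1 by rewrite invr_ge0 ltW.
  apply: blowup_psd => //; rewrite ler_peMl // ?ler1n //.
  by rewrite addn1.
have PP : P *m P = adj_mx R (Spl m G) *m adj_mx R (Spl m G).
  (* Eliminating m in favour of s leaves rational identities in s alone. *)
  have m_eq : m%:R = (s ^+ 2 - 1) / 4 :> R by rewrite s_sqr; field.
  rewrite adj_mx_blowup !blowup_sqr BB natrD natrM m_eq.
  by congr (blowup _ _ _ _ _); field.
have EG v : vertex_energy R v = B (enum_rank v) (enum_rank v).
  exact: vertex_energy_sqrt.
have ES w : vertex_energy R w = P (enum_rank w) (enum_rank w).
  exact: vertex_energy_sqrt.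
by split=> [v|v k]; rewrite EG ES blowupE.
Qed.
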